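(* Let $n,d$ be nonnegative integers and suppose $k\in\mathbb{N}$ with $k\ge c(Q_n)$ satisfies $k<\frac{2^n}{\sum_{i=0}^d\binom{n}{i}}$. Then $\mathrm{capt}_k(Q_n)>d$. In particular, this lower bound holds provided $k<\frac12\cdot 2^n\left(\frac{d}{en}\right)^d$ for some $d\le n/3$.
   Context: $Q_n$ is the $n$-dimensional hypercube on $2^n$ vertices, viewed as a reflexive graph, with cop number $c(Q_n)$. The game of Cops and Robbers: cops choose starting vertices (round 0), then the robber; players alternate, cops (any subset) moving to adjacent vertices or staying put, then the robber moving or staying; cops win by occupying the robber's vertex. For $k\ge c(G)$, $\mathrm{capt}_k(G)$ is the minimum over $k$-cop strategies of the number of rounds (excluding round 0) until capture against an optimally evading robber. *)

(* Defs.v *)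
From mathcomp Require Import all_boot all_order all_algebra.
From mathcomp Require Import all_classical all_reals all_analysis.

Set Implicit Arguments.
Unset Strict Implicit.
Unset Printing Implicit Defensive.

Record rgraph := RGraph {
  vertex :> finType;
  adj : rel vertex;
  adj_refl : reflexive adj;
  adj_sym : symmetric adj }.

Definition hamming (n : nat) (x y : {ffun 'I_n -> bool}) : nat :=
  #|[set i | x i != y i]|.

Definition hypercube_adj (n : nat) : rel {ffun 'I_n -> bool} :=
  fun x y => (x == y) || (hamming x y == 1).

Lemma hypercube_adj_refl (n : nat) : reflexive (@hypercube_adj n).
Proof. by move=> x; rewrite /hypercube_adj eqxx. Qed.

Lemma hypercube_adj_sym (n : nat) : symmetric (@hypercube_adj n).
Proof.
move=> x y; rewrite /hypercube_adj eq_sym /hamming; congr (_ || (_ == _)).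
by apply: eq_card => i; rewrite !inE eq_sym.
Qed.

Definition hypercube (n : nat) : rgraph :=
  RGraph (@hypercube_adj_refl n) (@hypercube_adj_sym n).

Section Game.
Variables (G : rgraph) (k : nat).

Definition cops := {ffun 'I_k -> G}.

(* [move h c r] is the cops' answer to the position with cops at [c] and the
   robber at [r]; [h] lists the positions at the end of all earlier rounds,
   most recent first, so strategies may depend on the whole past. *)
Record cop_strategy := CopStrategy {
  start : cops;
  move : seq (cops * G) -> cops -> G -> cops;
  move_adj : forall h (c : cops) r i, adj (c i) (move h c r i) }.

(* Against a fixed cop strategy, a robber strategy amounts to the trajectory it
   produces; [r t] is the robber's vertex at the end of round [t]. *)
Definition robber_walk (r : nat -> G) : Prop := forall t, adj (r t) (r t.+1).

Fixpoint play (S : cop_strategy) (r : nat -> G) (t : nat) :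
    seq (cops * G) * cops :=
  if t is s.+1 then
    let: (h, c) := play S r s in ((c, r s) :: h, move S h c (r s))
  else ([::], start S).

Definition cops_at (S : cop_strategy) (r : nat -> G) (t : nat) : cops :=
  (play S r t).2.

(* A cop may occupy the robber's vertex after the robber's turn of round [t],
   or, when [t > 0], already after the cops' turn of that round, at which point
   the robber is still at [r t.-1]. *)
Definition caught (S : cop_strategy) (r : nat -> G) (t : nat) : Prop :=
  (exists i, cops_at S r t i = r t) \/
  (0 < t /\ exists i, cops_at S r t i = r t.-1).

Definition capture_round (S : cop_strategy) (r : nat -> G) (t : nat) : Prop :=
  caught S r t /\ forall s, caught S r s -> t <= s.

Definition winning (S : cop_strategy) : Prop :=
  forall r, robber_walk r -> exists t, capture_round S r t.

(* [t] is the maximum of the capture round over all robber trajectories; no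
   such [t] exists if some trajectory evades capture forever. *)
Definition worst_capture_round (S : cop_strategy) (t : nat) : Prop :=
  (exists2 r, robber_walk r & capture_round S r t) /\
  (forall r, robber_walk r -> exists2 s, capture_round S r s & s <= t).

End Game.

(* Minimum of a set of natural numbers, with value 0 on the empty set. *)
Definition least (P : nat -> Prop) : nat :=
  xget 0 [set m | P m /\ forall p, P p -> m <= p]%classic.

Definition cop_number (G : rgraph) : nat :=
  least (fun k => exists S : cop_strategy G k, winning S).

(* On a nonempty graph, the default value 0 is only taken when
   [k < cop_number G]. *)
Definition capt (k : nat) (G : rgraph) : nat :=
  least (fun t => exists S : cop_strategy G k, worst_capture_round S t).

(* Main.v *)
Require Import Defs.
From mathcomp Require Import all_boot all_order all_algebra.
From mathcomp Require Import all_classical all_reals all_analysis.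
From mathcomp Require Import lra.

(** If the balls of radius [d] around the [k] starting positions do not cover
    the cube, a robber who sits still outside all of them survives [d] rounds.
    The minimum defining [capt] is attained: [c(Q_n) <= k] provides a winning
    strategy for [k] cops (surplus cops stay idle), and by König's lemma,
    applied to the finitely branching tree of robber trajectories, the capture
    times of a winning strategy are bounded. For the explicit bound, with
    [d <= n], [\sum_(i <= d) 'C(n, i) <= (n/d)^d (1 + d/n)^n <= (en/d)^d]. *)

Import Order.TTheory GRing.Theory Num.Theory.

(** * Attained minima of sets of naturals *)

Lemma ex_least {P : nat -> Prop} {m : nat} :
  P m -> exists2 t, P t & forall s, P s -> t <= s.
Proof.
move=> Pm; have exP : exists m, `[< P m >] by exists m; apply/asboolP.
case: (ex_minnP exP) => t /asboolP Pt tmin.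
by exists t => // s Ps; apply/tmin/asboolP.
Qed.

(** A witness [m] makes the set nonempty, so [xget] does not fall back on its default 0. *)
Lemma leastP (P : nat -> Prop) (m : nat) : P m -> P (least P).
Proof.
move=> /ex_least[t Pt tmin]; rewrite /least.
by case: xgetP => [y _ [] | /(_ t)[]].
Qed.

(** * Compactness of evasion and bounded capture times *)

Section Game.
Variables (G : Defs.rgraph) (k : nat).
Implicit Types (S : cop_strategy G k) (r : nat -> G).

(** Causality: in round [t] the cops answer to [r t.-1]. Hence finite prefixes decide capture, as
    the König argument requires. *)
Lemma play_eq_prefix S r r' t :
  (forall s, s < t -> r s = r' s) -> play S r t = play S r' t.
Proof.
elim: t => //= t IH rr'.
by rewrite IH ?rr' // => s st; apply/rr'/ltnW.
Qed.

Lemma caught_eq_prefix S r r' t :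
  (forall s, s <= t -> r s = r' s) -> caught S r t -> caught S r' t.
Proof.
move=> rr'; rewrite /caught /cops_at (@play_eq_prefix S r r') => [|s /ltnW]; last exact: rr'.
by rewrite !rr' // leq_pred.
Qed.

Lemma mkseq_inj r r' t : mkseq r t = mkseq r' t -> forall s, s < t -> r s = r' s.
Proof. by move=> e s st; rewrite -(nth_mkseq (r 0) r st) e nth_mkseq. Qed.

Lemma konig_evasion S :
  (forall N, exists2 r, robber_walk r & forall s, s <= N -> ~ caught S r s) ->
  exists2 r, robber_walk r & forall s, ~ caught S r s.
Proof.
move=> evade.
(* The evading walk through [p] may change with [N]; these prefixes form the infinite tree. *)
pose good (p : seq G) := forall N, exists r, [/\ robber_walk r,
  mkseq r (size p) = p & forall s, s <= N -> ~ caught S r s].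
have good0 : good [::] by move=> N; have [r rw rN] := evade N; exists r.
(* With [good p] under the existential, [choice] gives a total [f]; [r0 0] is a filler for bad
   [p]. *)
have goodS (p : seq G) : exists x, good p -> good (rcons p x).
  have [r0 _ _] := evade 0.
  case: (pselect (good p)) => [gp|]; last by exists (r0 0).
  (* If each [x] failed by some bound [B x], a walk through [p] evading up to the maximum of [B],
     finite since [G] is, would refute the bound at its own next vertex. *)
  apply: contrapT => /forallNP bad.
  have /choice[B hB] : forall x, exists N, ~ exists r, [/\ robber_walk r,
      mkseq r (size (rcons p x)) = rcons p x & forall s, s <= N -> ~ caught S r s].
    by move=> x; apply: contrapT => /forallNP h; apply: (bad x) => _ N; apply: contrapT; apply: h.
  have [r [rw rp rN]] := gp (\max_x B x).
  case: (hB (r (size p))); exists r; split=> // [|s sB].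
    by rewrite size_rcons mkseqS rp.
  by apply: rN; apply: leq_trans sB _; apply: leq_bigmax.
have [f hf] := choice goodS.
pose P t := iter t (fun p => rcons p (f p)) [::].
pose r t := f (P t).
have PE t : P t = mkseq r t by elim: t => //= t IH; rewrite mkseqS -IH.
have goodP t N : exists r', [/\ robber_walk r', forall s, s < t -> r' s = r s
    & forall s, s <= N -> ~ caught S r' s].
  have : good (P t) by elim: t => //= t; apply: hf.
  move=> /(_ N)[r' [w e c]]; exists r'; split=> //.
  by apply: mkseq_inj; move: e; rewrite PE size_mkseq.
exists r => t.
  (* Adjacency involves rounds [t] and [t.+1], hence a prefix of length [t.+2]. *)
  have [r' [w e _]] := goodP t.+2 0.
  by rewrite -!e //; apply: w.
have [r' [_ e c]] := goodP t.+1 t.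
by move=> /(@caught_eq_prefix S r r')-/(_ (fun s st => esym (e s st))); apply: c.
Qed.

Lemma winning_worst_capture_round (x0 : G) S :
  winning S -> exists t, worst_capture_round S t.
Proof.
move=> win.
have [N hN] : exists N, forall r, robber_walk r -> exists2 s, s <= N & caught S r s.
  apply: contrapT => /forallNP unbounded.
  case: (konig_evasion S) => [N|r /win[t [ct _]] /(_ t)//].
  have /existsNP[r /not_implyP[rw rN]] := unbounded N.
  by exists r => // s sN cs; apply: rN; exists s.
(* The capture rounds are bounded by [N], and the robber resting at [x0] makes them nonempty, so a
   maximum exists. *)
pose A t := `[< exists2 r, robber_walk r & capture_round S r t >].
have AN t : A t -> t <= N.
  move=> /asboolP[r rw [_ tmin]]; have [s sN cs] := hN r rw.
  exact: leq_trans (tmin s cs) sN.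
have exA : exists t, A t.
  have w0 : robber_walk (fun=> x0) by move=> t; apply: adj_refl.
  by have [t ct] := win _ w0; exists t; apply/asboolP; exists (fun=> x0).
case: (ex_maxnP exA AN) => t /asboolP At tmax; exists t; split=> // r rw.
by have [s cs] := win r rw; exists s => //; apply/tmax/asboolP; exists r.
Qed.

End Game.

(** * Adding idle cops *)

Section MoreCops.
Variables (G : Defs.rgraph) (x0 : G) (c k : nat) (ck : c <= k) (S : cop_strategy G c).

Let restr (C : cops G k) : cops G c := [ffun i => C (widen_ord ck i)].
Let restr_hist := map (fun q : cops G k * G => (restr q.1, q.2)).

(** At an index at least [c], [insub] fails: that cop starts at [x0] and never moves. The others
    replay [S] on the history restricted to them. *)
Let more_start : cops G k :=
  [ffun i => if insub (val i) is Some j then start S j else x0].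
Let more_move h (C : cops G k) (x : G) : cops G k :=
  [ffun i => if insub (val i) is Some j
             then move S (restr_hist h) (restr C) x j else C i].

Let more_adj h (C : cops G k) x i : adj (C i) (more_move h C x i).
Proof.
rewrite ffunE; case: insubP => [j _ ji|_]; last exact: adj_refl.
have -> : i = widen_ord ck j by apply: val_inj.
by have := move_adj S (restr_hist h) (restr C) x j; rewrite [restr C j]ffunE.
Qed.

Let more_cops : cop_strategy G k := @CopStrategy G k more_start more_move more_adj.

Let play_more_cops r t :
  play S r t = (restr_hist (play more_cops r t).1, restr (play more_cops r t).2).
Proof.
elim: t => [|t IH] /=.
  by congr pair; apply/ffunP => i; rewrite !ffunE valK.
rewrite IH; case: (play more_cops r t) => h C /=.
by congr pair; apply/ffunP => i; rewrite !ffunE valK.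
Qed.

Lemma winning_more_cops : winning S -> exists S' : cop_strategy G k, winning S'.
Proof.
move=> win; exists more_cops => r /win[t [ct _]].
have cE i : cops_at S r t i = cops_at more_cops r t (widen_ord ck i).
  by rewrite /cops_at play_more_cops ffunE.
have : caught more_cops r t.
  case: ct => [[i hi]|[t0 [i hi]]]; [left|right; split=> //];
  by exists (widen_ord ck i); rewrite -cE.
by move=> /ex_least[s cs smin]; exists s.
Qed.

End MoreCops.

(** A cop on every vertex captures in round 0; this makes the set behind [cop_number] nonempty. *)
Lemma winning_card_cops (G : Defs.rgraph) : exists S : cop_strategy G #|G|, winning S.
Proof.
exists (@CopStrategy G #|G| [ffun i => enum_val i] (fun _ C _ => C)
  (fun _ C _ i => adj_refl (C i))) => r _.
by exists 0; split=> //; left; exists (enum_rank (r 0)); rewrite ffunE enum_rankK.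
Qed.

Lemma capt_attained (G : Defs.rgraph) (x0 : G) (k : nat) :
  cop_number G <= k -> exists S : cop_strategy G k, worst_capture_round S (capt k G).
Proof.
move=> ck.
have [S winS] := leastP (fun k => exists S : cop_strategy G k, winning S) _ (winning_card_cops G).
have [S' winS'] := @winning_more_cops G x0 _ k ck S winS.
have [t wt] := @winning_worst_capture_round G k x0 S' winS'.
by apply: (leastP (fun t => exists S : cop_strategy G k, worst_capture_round S t) t); exists S'.
Qed.

(** * Hamming balls and the resting robber *)

Section Hamming.
Variable n : nat.
Implicit Types x y z : hypercube n.

Lemma hammingxx x : hamming x x = 0.
Proof. by apply: eq_card0 => i; rewrite !inE eqxx. Qed.

Lemma hamming_triangle x y z : hamming x z <= hamming x y + hamming y z.
Proof.
apply: leq_trans (leq_card_setU _ _); apply/subset_leq_card/fintype.subsetP => i.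
by rewrite !inE; case: (x i =P y i) => [->|].
Qed.

Lemma hamming_adj x y : adj x y -> hamming x y <= 1.
Proof. by case/orP => [/eqP->|/eqP->//]; rewrite hammingxx. Qed.

(** Sending [y] to the set of coordinates where it differs from [x] embeds the ball into the subsets
    of size at most [d], counted level by level. *)
Lemma card_hamming_ball x d :
  #|[set y | hamming x y <= d]| <= \sum_(0 <= i < d.+1) 'C(n, i).
Proof.
pose diff y : {set 'I_n} := [set i | x i != y i].
have diff_inj : injective diff.
  move=> y z /setP e; apply/ffunP => i; have := e i; rewrite !inE.
  by case: (x i) (y i) (z i) => [] [] [].
rewrite -(card_imset _ diff_inj).
apply: (@leq_trans #|[set A : {set 'I_n} | #|A| <= d]|).
  by apply/subset_leq_card/fintype.subsetP => _ /imsetP[y yd ->]; move: yd; rewrite !inE.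
have level i : #|[set A : {set 'I_n} | #|A| == i]| = 'C(n, i).
  by rewrite card_draws card_ord.
elim: d => [|d IH].
  rewrite big_nat1 -level; apply/subset_leq_card/fintype.subsetP => A.
  by rewrite !inE leqn0.
rewrite big_nat_recr //= -level; apply: leq_trans (leq_add IH (leqnn _)).
apply: leq_trans (leq_card_setU _ _); apply/subset_leq_card/fintype.subsetP => A.
by rewrite !inE leq_eqVlt orbC.
Qed.

Lemma hamming_cops_at k (S : cop_strategy (hypercube n) k) r t i :
  hamming (start S i) (cops_at S r t i) <= t.
Proof.
elim: t => [|t]; first by rewrite hammingxx.
rewrite /cops_at /=; case: (play S r t) => h C /= IH.
apply: leq_trans (hamming_triangle _ (C i) _) _.
by rewrite -addn1 leq_add // hamming_adj // move_adj.
Qed.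

(** Union bound: otherwise the [k] balls of radius [d] would cover all [2 ^ n] vertices. *)
Lemma exists_far_vertex k d (C : cops (hypercube n) k) :
  k * \sum_(0 <= i < d.+1) 'C(n, i) < 2 ^ n ->
  exists v : hypercube n, forall i, d < hamming (C i) v.
Proof.
move=> small; apply: contrapT => /forallNP near.
suff : 2 ^ n <= k * \sum_(0 <= i < d.+1) 'C(n, i) by rewrite leqNgt small.
have <- : #|[set: hypercube n]| = 2 ^ n.
  by rewrite cardsT card_ffun card_bool card_ord.
apply: (@leq_trans #|\bigcup_(i < k) [set v | hamming (C i) v <= d]|).
  apply/subset_leq_card/fintype.subsetP => v _.
  have /existsNP[i /negP] := near v; rewrite -leqNgt => vi.
  by apply/bigcupP; exists i => //; rewrite inE.
rewrite -[X in _ <= X * _]card_ord -sum_nat_const.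
elim/big_rec2: _ => [|i m A _ IH]; first by rewrite cards0.
apply: leq_trans (leq_card_setU _ _) (leq_add _ IH).
exact: card_hamming_ball.
Qed.

Lemma capt_hypercube_gt d k :
  cop_number (hypercube n) <= k ->
  k * \sum_(0 <= i < d.+1) 'C(n, i) < 2 ^ n -> d < capt k (hypercube n).
Proof.
move=> ck small.
have [S [_ worst]] := @capt_attained (hypercube n) [ffun=> false] k ck.
have [v far] := exists_far_vertex _ _ (start S) small.
have [|s [cs _]] := worst (fun=> v); first by move=> t; apply: adj_refl.
apply: leq_trans.
(* For a constant walk both alternatives of [caught] put a cop on [v]; that cop has travelled more
   than [d], at most one step per round. *)
have [i hi] : exists i, cops_at S (fun=> v) s i = v by case: cs => [|[]].
by apply: leq_trans (far i) _; rewrite -{1}hi hamming_cops_at.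
Qed.

End Hamming.

(** * The exponential estimate and the explicit bound *)

Local Open Scope ring_scope.

Lemma sum_binomial_le_expR (R : realType) (n d : nat) :
  (d <= n)%N -> (0 < d)%N ->
  (\sum_(0 <= i < d.+1) 'C(n, i))%N%:R <= (expR 1 * n%:R / d%:R) ^+ d :> R.
Proof.
move=> dn d0; have n0 : (0 < n)%N by apply: leq_trans dn.
have d0R : 0 < d%:R :> R by rewrite ltr0n.
have n0R : 0 < n%:R :> R by rewrite ltr0n.
pose x : R := d%:R / n%:R.
have x0 : 0 < x by rewrite divr_gt0.
have x1 : x <= 1 by rewrite ler_pdivrMr // mul1r ler_nat.
have -> : expR 1 * n%:R / d%:R = expR 1 / x :> R by rewrite invf_div mulrA.
rewrite expr_div_n ler_pdivlMr ?exprn_gt0 //.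
(* Since [n * x = d], the target becomes an [n]-th power, comparable with [(1 + x) ^+ n] through
   [1 + x <= expR x]. *)
have -> : expR 1 ^+ d = expR x ^+ n :> R.
  by rewrite -!expRM_natl mulr1 /x mulrC divfK // gt_eqF.
(* Termwise against the binomial expansion: [x ^+ d <= x ^+ i] for [i <= d] because [0 < x <= 1],
   and the terms beyond [d] are nonnegative. *)
have Cx : (\sum_(0 <= i < d.+1) 'C(n, i))%N%:R * x ^+ d <= (1 + x) ^+ n.
  rewrite exprDn natr_sum mulr_suml big_mkord.
  rewrite (big_ord_widen n.+1 (fun i => 'C(n, i)%:R * x ^+ d)) //.
  rewrite big_mkcond; apply: ler_sum => i _.
  rewrite expr1n mul1r -[leRHS]mulr_natl; case: ifP => [id|_]; last first.
    by rewrite mulr_ge0 // exprn_ge0 // ltW.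
  by rewrite ler_wpM2l // ler_wiXn2l // ltW.
apply: le_trans Cx _.
by rewrite lerXn2r ?nnegrE ?expR_ge0 ?addr_ge0 ?expR_ge1Dx // ltW.
Qed.

Theorem theorem3p5 (R : realType) (n d k : nat)
    (hk : (cop_number (hypercube n) <= k)%N) :
  (k%:R < 2 ^+ n / (\sum_(0 <= i < d.+1) 'C(n, i))%N%:R :> R ->
     (d < capt k (hypercube n))%N) /\
  (d%:R <= n%:R / 3 :> R ->
   k%:R < 1 / 2 * 2 ^+ n * (d%:R / (expR 1 * n%:R)) ^+ d :> R ->
     (d < capt k (hypercube n))%N).
Proof.
have sum_gt0 : 0 < (\sum_(0 <= i < d.+1) 'C(n, i))%N%:R :> R.
  by rewrite ltr0n big_nat_recl //= bin0.
have first_bound : k%:R < 2 ^+ n / (\sum_(0 <= i < d.+1) 'C(n, i))%N%:R :> R ->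
    (d < capt k (hypercube n))%N.
  rewrite ltr_pdivlMr // -natrM -natrX ltr_nat.
  exact: capt_hypercube_gt.
split=> // dn hkd; apply: first_bound; apply: lt_le_trans hkd _.
have p0 : 0 < 2 ^+ n :> R by rewrite exprn_gt0.
rewrite [1 / 2 * _]mulrC -mulrA ler_pM2l //.
(* At [d = 0] the power is 1 and the claim reads [1 / 2 <= 1]; the estimate by [y] divides by
   [d]. *)
case: (posnP d) => [->|d0].
  by rewrite expr0 big_nat1 bin0; lra.
have le_dn : (d <= n)%N by rewrite -(ler_nat R); have := ler0n R n; lra.
have -> : d%:R / (expR 1 * n%:R) = (expR 1 * n%:R / d%:R)^-1 :> R.
  by rewrite invf_div.
have sy := sum_binomial_le_expR R n d le_dn d0; move: sum_gt0 sy.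
set s : R := (\sum_(_ <= _ < _) _)%N%:R; set y := expR 1 * _ / _ => s0 sy.
have y0 : 0 < y ^+ d := lt_le_trans s0 sy.
rewrite exprVn; apply: (@le_trans _ _ (y ^+ d)^-1); last by rewrite lef_pV2 ?posrE.
by rewrite ger_pMl ?invr_gt0 //; lra.
Qed.
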